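(* Let $X,Y$ be analytic subsets of a standard Borel space and let $K\colon X\to Y$ be an analytic map. Assume that $E\subseteq X^2$ and $F\subseteq Y^2$ are Borel equivalence relations, and that $(E_\alpha)_{\alpha<\omega_1}$ and $(F_\alpha)_{\alpha<\omega_1}$ are refining uniformly analytic equivalence relations on $X$ and $Y$ respectively; put $E_\infty=\bigcap_{\alpha<\omega_1}E_\alpha$ and $F_\infty=\bigcap_{\alpha<\omega_1}F_\alpha$. Suppose that for all $x,x'\in X$, $$K(x)\,F_\infty\,K(x')\Rightarrow x\,E\,x'\qquad\text{and}\qquad x\,E_\infty\,x'\Rightarrow K(x)\,F\,K(x').$$ Then there exist $\alpha,\beta<\omega_1$ such that for all $x,x'\in X$, $$K(x)\,F_\alpha\,K(x')\Rightarrow x\,E\,x'\qquad\text{and}\qquad x\,E_\beta\,x'\Rightarrow K(x)\,F\,K(x').$$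
   Context: A subset of a standard Borel space is analytic if it is the image of a Borel set under a Borel map. For a subset $X$ of a standard Borel space $Z$, Borel/analytic subsets of $X$ are understood relative to $X$ (intersections of $X$ with Borel/analytic subsets of $Z$), and similarly for products. A map between analytic sets is analytic if its graph is analytic in the product. $\mathrm{LO}\subseteq\mathcal P(\omega)\times\mathcal P(\omega^2)$ is the (standard Borel) set of linear orders on subsets of $\omega$. A family $R\subseteq Z\times\mathcal I$ indexed by $\mathcal I\subseteq\mathrm{LO}$, with sections $R_I=\{z:(z,I)\in R\}$, is refining if $R_I\supseteq R_{I'}$ whenever $I$ embeds into $I'$ (as linear orders). For a countable ordinal $\alpha$ write $R_\alpha$ for $R_I$, where $I\in\mathrm{LO}$ is any order isomorphic to $\alpha$; $\omega^*$ denotes the reverse of the usual order on $\omega$. A family $(E_\alpha)_{\alpha<\omega_1}$ of equivalence relations on $X$ is a refining analytic equivalence relation if each $E_\alpha\subseteq X^2$ is an analytic equivalence relation and $E_\alpha\supseteq E_\beta$ whenever $\alpha\le\beta$. It is uniformly analytic if there is an analytic refining family $R\subseteq X^2\times\mathrm{LO}$ with $E_\alpha=R_\alpha$ for each $\alpha<\omega_1$ and $R_{\omega^*}=\bigcap_{\alpha<\omega_1}E_\alpha$. *)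

(* Defs.v *)
From HB Require Import structures.
From mathcomp Require Import all_boot all_order all_algebra.
From mathcomp Require Import all_classical all_reals all_analysis.

Set Implicit Arguments.
Unset Strict Implicit.
Unset Printing Implicit Defensive.

Local Open Scope classical_set_scope.

Definition polish (R : realType) (P : metricType R) : Prop :=
  (forall F : set_system P, ProperFilter F -> cauchy F -> exists l : P, F --> l)
  /\ (exists2 S : set P, countable S & dense S).

(* The points of [T] are transported to a Polish space along a bijection, so
   that [T] need not itself carry a topology. *)
Definition standard_borel (R : realType) (d : measure_display)
    (T : measurableType d) : Prop :=
  exists2 P : metricType R, polish P &
  exists2 f : T -> P, bijective f &
  d.-measurable = preimage_set_system setT f <<s @open P >>.

Definition analytic (R : realType) (d : measure_display) (T : measurableType d)
    (A : set T) : Prop :=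
  exists (d' : measure_display) (W : measurableType d'),
  standard_borel R W /\
  exists (B : set W) (f : W -> T),
    [/\ measurable B, measurable_fun B f & A = f @` B].

Definition borel_in (d : measure_display) (T : measurableType d)
    (D A : set T) : Prop :=
  exists2 B : set T, measurable B & A = D `&` B.

Definition analytic_in (R : realType) (d : measure_display)
    (T : measurableType d) (D A : set T) : Prop :=
  exists2 B : set T, analytic R B & A = D `&` B.

Definition analytic_map (R : realType) (d1 d2 : measure_display)
    (T1 : measurableType d1) (T2 : measurableType d2) (X : set T1) (Y : set T2)
    (K : {fun X >-> Y}) : Prop :=
  analytic_in R (X `*` Y) [set p : T1 * T2 | X p.1 /\ p.2 = K p.1].

Definition equivalence_on (T : Type) (X : set T) (E : set (T * T)) : Prop :=
  [/\ E `<=` X `*` X,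
      forall x, X x -> E (x, x),
      forall x y, E (x, y) -> E (y, x) &
      forall x y z, E (x, y) -> E (y, z) -> E (x, z)].

(* The power set of a countable type, with the Borel sigma-algebra of the
   product topology of 2^T: the sets {A | n \in A} and their complements are
   the subbasic clopen sets. *)
Notation Pow T :=
  (g_sigma_algebraType [set [set A : set T | A n] | n in [set: T]]).

(* A code [I] stands for the order [I.2] on the subset [I.1] of [nat], with
   [I.2 (m, n)] meaning that m is below or equal to n. *)
Notation LOcode := (Pow nat * Pow (nat * nat))%type.

Definition LO : set LOcode :=
  [set I | [/\ I.2 `<=` I.1 `*` I.1,
               forall m, I.1 m -> I.2 (m, m),
               forall m n, I.2 (m, n) -> I.2 (n, m) -> m = n,
               forall m n k, I.2 (m, n) -> I.2 (n, k) -> I.2 (m, k) &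
               forall m n, I.1 m -> I.1 n -> I.2 (m, n) \/ I.2 (n, m)]].

Definition embedding (I J : LOcode) (f : nat -> nat) : Prop :=
  set_fun I.1 J.1 f /\
  forall m n, I.1 m -> I.1 n -> (I.2 (m, n) <-> J.2 (f m, f n)).

Definition embeds (I J : LOcode) : Prop := exists f, embedding I J f.

Definition isomorphic (I J : LOcode) : Prop :=
  exists2 f, embedding I J f & set_bij I.1 J.1 f.

Definition initially_embeds (I J : LOcode) : Prop :=
  exists2 f, embedding I J f &
  forall m n, I.1 m -> J.2 (n, f m) -> exists2 k, I.1 k & f k = n.

Definition well_ordered (I : LOcode) : Prop :=
  LO I /\
  forall S : set nat, S `<=` I.1 -> S !=set0 ->
  exists2 m, S m & forall n, S n -> I.2 (m, n).

(* Countable ordinals (finite ones included) are the isomorphism classes in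
   [LO] of well-orders of subsets of [nat]; [order_class a I] means that
   [I] is isomorphic to the ordinal [a]. *)
Record omega1 : Type := Omega1 {
  order_class : set LOcode ;
  order_classP : exists2 I, well_ordered I &
    order_class = [set J | LO J /\ isomorphic I J] }.

Definition ole (a b : omega1) : Prop :=
  exists I J, [/\ order_class a I, order_class b J & initially_embeds I J].

Definition omega_star : LOcode :=
  ([set: nat], [set p : nat * nat | (p.2 <= p.1)%N]).

Definition refining_family (T : Type) (Q : set (T * LOcode)) : Prop :=
  forall I J, LO I -> LO J -> embeds I J -> ysection Q J `<=` ysection Q I.

Definition refining_analytic_equivalence (R : realType) (d : measure_display)
    (T : measurableType d) (X : set T) (E : omega1 -> set (T * T)) : Prop :=
  (forall a, equivalence_on X (E a) /\ analytic_in R (X `*` X) (E a)) /\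
  (forall a b, ole a b -> E b `<=` E a).

Definition uniformly_analytic (R : realType) (d : measure_display)
    (T : measurableType d) (X : set T) (E : omega1 -> set (T * T)) : Prop :=
  exists Q : set ((T * T) * LOcode),
    [/\ analytic_in R ((X `*` X) `*` LO) Q,
        refining_family Q,
        forall (a : omega1) (I : LOcode), order_class a I -> E a = ysection Q I &
        ysection Q omega_star = \bigcap_(a in [set: omega1]) E a].

(* Main.v *)
Require Import Defs.
From mathcomp Require Import all_boot all_order all_algebra.
From mathcomp Require Import all_classical all_reals all_analysis.

Set Implicit Arguments.
Unset Strict Implicit.
Unset Printing Implicit Defensive.

Import Order.TTheory GRing.Theory Num.Theory.

Local Open Scope classical_set_scope.

(** The theorem is a reflection argument whose engine is the fact that the set
of well-orders is not analytic in [LO].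

Let [N] be the set of pairs [(K x, K x')] with [x], [x'] in [X] not
[E]-related.  It is analytic, and the hypothesis on [F_oo] says that it misses
the section of the uniformizing family [Q] at the reverse order of [omega].
Suppose that [N] met every [F_ a].  The set [D] of codes [I] such that [N] meets
the section of [Q] at [I] is analytic and contains every well-order.  An
ill-founded linear order [I] has a copy of [omega_star] in it, so by refinement
its section is contained in the one at [omega_star], and [I] is not in [D].
Hence [D] is exactly the set of well-orders among linear orders, which is
impossible.  So some [F_ a] misses [N], which is the first implication of the
conclusion; the second is the same argument for the set of pairs [(x, x')] such
that [K x] and [K x'] are not [F]-related.  Both are instances of
[coded_avoids_some_stage].

That well-orders do not form an analytic set ([well_orders_not_coded]) is shown
by a diagonal argument.  If [D] is the projection of a closed subset of Baire
space, each [d] has a tree [T_d] of finite sequences which has an infinite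
branch iff [d] is in [D], and the Kleene-Brouwer order of a tree is a well-order
iff the tree has no branch.  Membership of a sequence [s] of length [n] in [T_d]
depends only on the first [n] values of [d], and [n] is at most the code of [s];
so [d] can be chosen by recursion to be the characteristic function of its own
tree.  For this [d], the order coded by [d] is a well-order iff [d] is not in
[D].

Analytic sets are handled through partial codings by Baire space
([baire_coded]) for which preimages of measurable sets are Suslin sets, that is
projections of closed sets.  Completeness enters once, to show that analytic sets
have codings ([analytic_coded]); closure under products, measurable images and
preimages is then proved for codings alone, so that no product of Polish spaces
has to be formed. *)

(** * Closed sets and Suslin sets of Baire space *)

Local Notation baire := (nat -> nat).

Definition agree (n : nat) (x y : baire) : Prop :=
  forall i, (i < n)%N -> x i = y i.

Lemma agree_sym n x y : agree n x y -> agree n y x.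
Proof. by move=> xy i /xy ->. Qed.

Lemma agree_le m n x y : (m <= n)%N -> agree n x y -> agree m x y.
Proof. by move=> mn xy i im; apply: xy; exact: leq_trans mn. Qed.

(** Closedness for the product topology: cylinders are the basic neighborhoods. *)
Definition baire_closed (C : set baire) : Prop :=
  forall x, (forall n, exists2 y, agree n x y & C y) -> C x.

Lemma baire_closed_finitary n (C : set baire) :
  (forall x y, agree n x y -> C x -> C y) -> baire_closed C.
Proof. by move=> Cn x /(_ n)[y /agree_sym]; exact: Cn. Qed.

Lemma baire_closed_bigcap I (D : set I) (C : I -> set baire) :
  (forall i, baire_closed (C i)) -> baire_closed (\bigcap_(i in D) C i).
Proof.
move=> clC x xC i Di; apply: clC => n.
by have [y xy /(_ i Di)] := xC n; exists y.
Qed.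

Lemma baire_closedI (A B : set baire) :
  baire_closed A -> baire_closed B -> baire_closed (A `&` B).
Proof.
by move=> clA clB x xAB; split; [apply: clA|apply: clB] => n;
  have [y xy [Ay By]] := xAB n; exists y.
Qed.

Lemma baire_closed_reindex h C :
  baire_closed C -> baire_closed [set x : baire | C (x \o h)].
Proof.
move=> clC x xC; apply: clC => n.
have [y xy Cy] := xC (\max_(i < n) (h i).+1)%N.
exists (y \o h) => // i ltin; apply: xy.
exact: (leq_bigmax (Ordinal ltin)).
Qed.

(** The value [x p] is locally constant, so it may select which closed condition
is imposed on [x]; this is what makes countable unions of Suslin sets Suslin. *)
Lemma baire_closed_cases p (C : nat -> set baire) :
  (forall k, baire_closed (C k)) -> baire_closed [set x | C (x p) x].
Proof.
move=> clC x xC; apply: clC => n.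
have [y xy Cy] := xC (maxn n p.+1); exists y.
  by apply: agree_le xy; rewrite leq_maxl.
by rewrite (xy p) // leq_maxr.
Qed.

Lemma baire_closed_eq (f g : nat -> nat) :
  baire_closed [set x : baire | x \o f = x \o g].
Proof.
move=> x xfg; apply/funext => n /=.
have [y xy /(congr1 (@^~ n))/= yfg] := xfg (maxn (f n) (g n)).+1.
by rewrite !xy // ltnS ?leq_maxl ?leq_maxr.
Qed.

Definition cell (k n : nat) : nat := pickle (k, n).

(** A point of Baire space holds countably many points, one in each strand. *)
Definition strand (k : nat) (z : baire) : baire := z \o cell k.

Definition weave (x : nat -> baire) : baire :=
  fun m => if unpickle m is Some (k, n) then x k n else 0%N.

Lemma strand_weave x k : strand k (weave x) = x k.
Proof. by apply/funext => n; rewrite /strand /weave /cell /= pickleK. Qed.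

(** Images under an arbitrary reindexing [z \o h], rather than under one fixed
projection: since reindexings compose, closure under reindexing images is then
immediate, and a witness may be laid out in [z] in whatever way is convenient. *)
Definition suslin (A : set baire) : Prop :=
  exists C h, baire_closed C /\ A = [set z \o h | z in C].

Lemma suslin_closed C : baire_closed C -> suslin C.
Proof.
by move=> clC; exists C, id; split=> //; rewrite image_id.
Qed.

Lemma suslin_reindex_image h A : suslin A -> suslin [set x \o h | x in A].
Proof.
move=> [C [k [clC ->]]]; exists C, (k \o h); split => //.
by rewrite image_comp.
Qed.

(** A witness for the intersection stores one witness for each [A k], strand by
strand; that they all project to the same point is a closed condition. *)
Lemma suslin_bigcap (A : nat -> set baire) :
  (forall k, suslin (A k)) -> suslin (\bigcap_k A k).
Proof.
move=> /choice[C /choice[h AE]].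
pose e k := cell k \o h k.
exists (\bigcap_k ([set z | C k (strand k z)] `&` [set z : baire | z \o e k = z \o e 0%N])),
  (e 0%N).
split.
  apply: baire_closed_bigcap => k.
  apply: baire_closedI; last exact: baire_closed_eq.
  by apply: baire_closed_reindex; case: (AE k).
apply/seteqP; split => [x Ax|_ [z zC <-] k _].
  have /choice[w wP] : forall k, exists z, C k z /\ z \o h k = x.
    by move=> k; have := Ax k I; rewrite (AE k).2 => -[z ? ?]; exists z.
  have wE k : weave w \o e k = x.
    by rewrite -(wP k).2 -[in RHS](strand_weave w k).
  exists (weave w); last exact: wE.
  by move=> k _; rewrite /= strand_weave !wE; split=> //; case: (wP k).
by have [Czk <-] := zC k I; rewrite (AE k).2; exists (strand k z).
Qed.

(** A witness for the union stores the selected index, the witness for the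
selected set, and a copy of the point itself: the reindexing producing the
point must not depend on the index. *)
Lemma suslin_bigcup (A : nat -> set baire) :
  (forall k, suslin (A k)) -> suslin (\bigcup_k A k).
Proof.
move=> /choice[C /choice[h AE]].
pose sel := cell 0 0.
pose e := cell 2.
pose D k := [set z | C k (strand 1 z)] `&`
  [set z : baire | z \o (cell 1 \o h k) = z \o e].
exists [set z | D (z sel) z], e; split.
  apply: baire_closed_cases => k; apply: baire_closedI; last exact: baire_closed_eq.
  by apply: baire_closed_reindex; case: (AE k).
apply/seteqP; split => [x [k _]|_ [z [Cz <-] <-]].
  rewrite (AE k).2 => -[y Cy <-].
  pose w := weave (fun i => if i is 0 then fun=> k else if i is 1 then y else y \o h k).
  exists w; last exact: (strand_weave _ 2).
  have wk : w sel = k by rewrite /w /weave /sel /cell pickleK.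
  rewrite /= wk; split; first by rewrite /= strand_weave.
  transitivity (strand 1 w \o h k) => //; transitivity (strand 2 w) => //.
  by rewrite !strand_weave.
by exists (z sel) => //; rewrite (AE _).2; exists (strand 1 z).
Qed.

Lemma suslinI A B : suslin A -> suslin B -> suslin (A `&` B).
Proof.
move=> sA sB.
have -> : A `&` B = \bigcap_k (if k is 0 then A else B).
  by apply/seteqP; split=> [x [Ax Bx] [|k] _|x AB] //; split; [exact: (AB 0%N)|exact: (AB 1%N)].
by apply: suslin_bigcap => -[].
Qed.

Lemma suslinU A B : suslin A -> suslin B -> suslin (A `|` B).
Proof.
move=> sA sB.
have -> : A `|` B = \bigcup_k (if k is 0 then A else B).
  apply/seteqP; split=> [x [Ax|Bx]|x [[|k] _ ?]]; [by exists 0%N|by exists 1%N|by left|by right].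
by apply: suslin_bigcup => -[].
Qed.

Lemma suslin_finitary n (A : set baire) :
  (forall x y, agree n x y -> A x -> A y) -> suslin A.
Proof. by move=> /baire_closed_finitary/suslin_closed. Qed.

Lemma suslin_reindex h A : suslin A -> suslin [set x : baire | A (x \o h)].
Proof.
move=> [C [k [clC ->]]].
exists ([set z | C (strand 1 z)] `&`
  [set z : baire | z \o (cell 1 \o k) = z \o (cell 0 \o h)]),
  (cell 0); split.
  by apply: baire_closedI; last exact: baire_closed_eq; apply: baire_closed_reindex.
apply/seteqP; split => [x [y Cy yx]|_ [z [Cz zE] <-]]; last by exists (strand 1 z).
pose w := weave (fun i => if i is 0 then x else y).
exists w; last exact: (strand_weave _ 0).
split; first by rewrite /= strand_weave.
transitivity (strand 1 w \o k) => //; transitivity (strand 0 w \o h) => //.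
by rewrite !strand_weave.
Qed.

(** * Sets coded by Baire space *)

Definition decoded_in (T : Type) (r : baire -> T -> Prop) (A : set T) :
  set baire := [set x | exists2 t, r x t & A t].

Definition functional_rel (S T : Type) (r : S -> T -> Prop) : Prop :=
  forall x t u, r x t -> r x u -> t = u.

(** Borel sets are Suslin: the sets which are Suslin together with their
complement form a sigma-algebra.  Complements are relative to the domain of the
coding; as a code names at most one point, naming a point outside each [B k]
amounts to naming a point outside their union. *)
Lemma suslin_decoded_sigma (T : Type) (r : baire -> T -> Prop) (G : set (set T)) :
  functional_rel r -> suslin (decoded_in r setT) ->
  (forall A, G A -> suslin (decoded_in r A) /\ suslin (decoded_in r (~` A))) ->
  forall A, <<s G >> A -> suslin (decoded_in r A).
Proof.
move=> rF r_dom rG A GA.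
suff /(_ A GA)[] : <<s G >> `<=`
  [set A | suslin (decoded_in r A) /\ suslin (decoded_in r (~` A))] by [].
apply: smallest_sub => //; split => /=.
- split; last by rewrite setC0.
  suff -> : decoded_in r set0 = set0.
    by apply: (@suslin_finitary 0) => x y _; exact.
  by apply/seteqP; split => // x [].
- by move=> B [rB rCB]; rewrite setTD setCK.
move=> B rB; split.
  have -> : decoded_in r (\bigcup_k B k) = \bigcup_k decoded_in r (B k).
    apply/seteqP; split => [x [t rt [k _ Bt]]|x [k _ [t rt Bt]]].
      by exists k => //; exists t.
    by exists t => //; exists k.
  by apply: suslin_bigcup => k; case: (rB k).
have -> : decoded_in r (~` \bigcup_k B k) = \bigcap_k decoded_in r (~` B k).
  apply/seteqP; split => [x [t rt Bt] k _|x rx].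
    by exists t => // Bkt; apply: Bt; exists k.
  have [t rt _] := rx 0%N I; exists t => // -[k _ Bkt].
  by have [u /(rF _ _ _ rt) <-] := rx k I.
by apply: suslin_bigcap => k; case: (rB k).
Qed.

(** A working form of analyticity: [A] is the range of a partial map on Baire
space which is measurable in the sense that preimages of measurable sets are
Suslin.  The condition for the full set makes the domain Suslin. *)
Definition baire_coded d (T : measurableType d) (A : set T) : Prop :=
  exists r : baire -> T -> Prop, [/\ functional_rel r,
    forall t, A t <-> exists x, r x t &
    forall B, measurable B -> suslin (decoded_in r B)].

Lemma baire_coded_image d1 d2 (S : measurableType d1) (T : measurableType d2)
    (A B : set S) (f : S -> T) :
  baire_coded A -> measurable B -> measurable_fun B f ->
  baire_coded (f @` (A `&` B)).
Proof.
move=> [r [rF rA rS]] mB mf.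
exists (fun x u => exists2 t, r x t & B t /\ f t = u); split.
- by move=> x _ _ [t rt [_ <-]] [u ru [_ <-]]; rewrite (rF _ _ _ rt ru).
- move=> u; split=> [[t [/rA[x rxt] Bt] <-]|[x [t rt [Bt <-]]]].
    by exists x, t.
  by exists t => //; split=> //; apply/rA; exists x.
move=> C mC; have := rS _ (mf mB _ mC); congr suslin.
apply/seteqP; split => [x [t rt [Bt Ct]]|x [_ [t rt [Bt <-]] Ct]].
  by exists (f t) => //; exists t.
by exists t.
Qed.

Lemma baire_codedX d1 d2 (S : measurableType d1) (T : measurableType d2)
    (A : set S) (B : set T) :
  baire_coded A -> baire_coded B -> baire_coded (A `*` B).
Proof.
move=> [r [rF rA rS]] [s [sF sB sS]].
pose q x (p : S * T) := r (strand 0 x) p.1 /\ s (strand 1 x) p.2.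
have q_rect C D : measurable C -> measurable D -> suslin (decoded_in q (C `*` D)).
  move=> mC mD.
  have -> : decoded_in q (C `*` D) =
    [set x | decoded_in r C (strand 0 x)] `&` [set x | decoded_in s D (strand 1 x)].
    apply/seteqP; split => [x [[t u] [/= rt su] [/= Ct Du]]|x [[t rt Ct] [u su Du]]].
      by split; [exists t|exists u].
    by exists (t, u).
  by apply: suslinI; apply: suslin_reindex; [exact: rS|exact: sS].
have qF : functional_rel q.
  move=> x [t u] [t' u'] [/= rt su] [/= rt' su'].
  by rewrite (rF _ _ _ rt rt') (sF _ _ _ su su').
exists q; split => //.
  move=> [t u]; split=> [[/= /rA[x rt] /sB[y su]]|[x [/= rt su]]].
    by exists (weave (fun i => if i is 0 then x else y)); split; rewrite strand_weave.
  by split; [apply/rA; exists (strand 0 x)|apply/sB; exists (strand 1 x)].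
apply: suslin_decoded_sigma => //; first by rewrite -setXTT; apply: q_rect.
move=> _ [[C mC <-]|[D mD <-]]; rewrite setTI.
  have -> : fst @^-1` C = C `*` setT :> set (S * T).
    by apply/seteqP; split => -[? ?] //= [].
  split; first exact: q_rect.
  have -> : ~` (C `*` setT) = (~` C) `*` setT :> set (S * T).
    by apply/seteqP; split => -[? ?] /= => [h|[h _] [//]]; split=> // ?; apply: h.
  by apply: q_rect => //; exact: measurableC.
have -> : snd @^-1` D = setT `*` D :> set (S * T).
  by apply/seteqP; split => -[? ?] //= [].
split; first exact: q_rect.
have -> : ~` (setT `*` D) = setT `*` (~` D) :> set (S * T).
  by apply/seteqP; split => -[? ?] /= => [h|[_ h] [//]]; split=> // ?; apply: h.
by apply: q_rect => //; exact: measurableC.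
Qed.

(** What standard Borel spaces provide to make equality a measurable relation. *)
Definition countably_separated d (T : measurableType d) : Prop :=
  exists2 U : nat -> set T, (forall k, measurable (U k)) &
    forall t u, (forall k, U k t <-> U k u) -> t = u.

Lemma countably_separatedX d1 d2 (S : measurableType d1) (T : measurableType d2) :
  countably_separated S -> countably_separated T ->
  countably_separated (S * T)%type.
Proof.
move=> [U mU sepU] [V mV sepV].
exists (fun k => if odd k then U k./2 `*` setT else setT `*` V k./2).
  by move=> k; case: ifP => _; exact: measurableX.
move=> [t t'] [u u'] tu; congr pair.
- apply: sepU => k; have := tu k.*2.+1.
  rewrite /= odd_double /= uphalf_double => -[h g].
  by split=> ?; [case: h|case: g].
- apply: sepV => k; have := tu k.*2.
  rewrite odd_double doubleK => -[h g].
  by split=> ?; [case: h|case: g].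
Qed.

Lemma measurable_equalizer d1 d2 (S : measurableType d1) (T : measurableType d2)
    (f g : S -> T) : countably_separated T ->
  measurable_fun setT f -> measurable_fun setT g ->
  measurable [set t | f t = g t].
Proof.
move=> [U mU sepU] mf mg.
have -> : [set t | f t = g t] = \bigcap_k
    ((f @^-1` U k `&` g @^-1` U k) `|` (f @^-1` (~` U k) `&` g @^-1` (~` U k))).
  apply/seteqP; split => [t /= fg k _|t h].
    by rewrite /= -fg; have [] := pselect (U k (f t)); [left|right].
  by apply: sepU => k; have [[]|[]] := h k I.
apply: bigcapT_measurable => k; apply: measurableU; apply: measurableI;
  rewrite -[X in measurable X]setTI; [exact: mf|exact: mg| |];
  by [apply: mf => //; exact: measurableC|apply: mg => //; exact: measurableC].
Qed.

(** The set is the projection of [A `*` B] cut down to the graph of [f], which is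
measurable since [T] is countably separated. *)
Lemma baire_coded_restrict_preimage d1 d2 (S : measurableType d1)
    (T : measurableType d2) (A : set S) (B : set T) (f : S -> T) :
  countably_separated T -> measurable_fun setT f ->
  baire_coded A -> baire_coded B -> baire_coded (A `&` f @^-1` B).
Proof.
move=> sepT mf cA cB.
have mD : measurable [set p : S * T | f p.1 = p.2].
  apply: (@measurable_equalizer _ _ _ _ (f \o fst) snd) => //.
  by apply: measurableT_comp => //; exact: measurable_fst.
have := baire_coded_image (f := fst) (baire_codedX cA cB) mD.
move=> /(_ (measurable_funS measurableT (@subsetT _ _) measurable_fst)).
congr baire_coded; apply/seteqP; split => [_ [[s t] [[/= As Bt] /= fs] <-]|s [As Bs]].
  by split=> //=; rewrite fs.
by exists (s, f s).
Qed.

Lemma suslin_preimage_sigma T (f : baire -> T) (G : set (set T)) :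
  (forall A, G A -> suslin (f @^-1` A) /\ suslin (f @^-1` (~` A))) ->
  forall A, <<s G >> A -> suslin (f @^-1` A).
Proof.
pose r x t := f x = t.
have rE A : decoded_in r A = f @^-1` A.
  by apply/seteqP; split => [x [_ <-]|x Afx] //; exists (f x).
move=> fG A GA; rewrite -rE; apply: suslin_decoded_sigma GA.
- by move=> x _ _ <- <-.
- by rewrite rE; apply: (@suslin_finitary 0).
- by move=> B /fG; rewrite !rE.
Qed.

(** A point [x] is in the preimage iff some [y] codes [f x]; separation turns the
equality of [f x] with the point coded by [y] into countably many conditions
which are Suslin in [x] and [y]. *)
Lemma suslin_preimage_coded d (T : measurableType d) (f : baire -> T) (A : set T) :
  countably_separated T ->
  (forall B, measurable B -> suslin (f @^-1` B)) ->
  baire_coded A -> suslin (f @^-1` A).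
Proof.
move=> [U mU sepU] fS [r [rF rA rS]].
pose both B := [set z | B (f (strand 0 z))] `&` [set z | decoded_in r B (strand 1 z)].
have suslin_both B : measurable B -> suslin (both B).
  move=> mB; apply: suslinI; last exact: (suslin_reindex (cell 1) (rS _ mB)).
  exact: (suslin_reindex (cell 0) (fS _ mB)).
have -> : f @^-1` A =
    [set z \o cell 0 | z in \bigcap_k (both (U k) `|` both (~` U k))].
  apply/seteqP; split => [x /= /rA[y ryx]|_ [z zU <-]].
    exists (weave (fun i => if i is 0 then x else y)); last exact: (strand_weave _ 0).
    move=> k _; rewrite /both /= !strand_weave.
    by have [] := pselect (U k (f x)); [left|right]; split => //; exists (f x).
  have [t [rt _]] : exists t, r (strand 1 z) t /\ True.
    by have [[_ [t rt _]]|[_ [t rt _]]] := zU 0%N I; exists t.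
  apply/rA; exists (strand 1 z); rewrite (_ : f _ = t) //.
  apply: sepU => k.
  by have [[fU [u ru Uu]]|[fU [u ru Uu]]] := zU k I; rewrite (rF _ _ _ rt ru).
apply: suslin_reindex_image; apply: suslin_bigcap => k.
by apply: suslinU; apply: suslin_both => //; exact: measurableC.
Qed.

(** * Standard Borel spaces and analytic sets are coded *)

Lemma open_metric_ball (R : realType) (P : metricType R) (p : P) (e : R) :
  open [set q | mdist p q < e]%R.
Proof.
rewrite openE => q /= pq; apply/nbhs_ballP; exists (e - mdist p q)%R => /=.
  by rewrite subr_gt0.
move=> t; rewrite ballEmdist /= => qt.
by apply: le_lt_trans (metric_triangle p q t) _; rewrite -ltrBrDl.
Qed.

Lemma natSinv_lt (R : realType) (e : R) : (0 < e)%R ->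
  exists N, forall n, (N <= n)%N -> (n.+1%:R^-1 < e)%R.
Proof.
by move=> e0; have [N _ hN] := near_infty_natSinv_lt (PosNum e0); exists N.
Qed.

Section PolishCoding.
Variables (R : realType) (P : metricType R) (S : set P) (g : P -> nat).
Hypothesis P_complete :
  forall F : set_system P, ProperFilter F -> cauchy F -> exists l : P, F --> l.
Hypothesis S_dense : dense S.
Hypothesis g_inj : {in S &, injective g}.

Let eps (n : nat) : R := (n.+1%:R^-1)%R.

Let eps_gt0 n : (0 < eps n)%R.
Proof. by rewrite invr_gt0 ltr0n. Qed.

Let S_inj s t : S s -> S t -> g s = g t -> s = t.
Proof. by move=> Ss St; apply: g_inj; rewrite inE. Qed.

Let S_near p n : exists2 s, S s & (mdist s p < eps n)%R.
Proof.
have [|s [ps Ss]] := S_dense _ (open_metric_ball p (eps n)).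
  by exists p; rewrite /= mdistxx eps_gt0.
by exists s => //; rewrite metric_sym.
Qed.

(** A name of [p] lists indices, under the injection [g], of points of the dense
set [S] converging to [p] at a prescribed rate.  The inequality is not strict so
that it survives limits, which is used to recognize the names. *)
Definition metric_name (x : baire) (p : P) : Prop :=
  forall n, exists2 s, S s /\ g s = x n & (mdist s p <= eps n)%R.

Let close_eq (p q : P) :
  (forall n, exists2 s, (mdist s p <= eps n)%R & (mdist s q <= eps n)%R) -> p = q.
Proof.
move=> pq; apply: mdist_positivity; apply/eqP.
rewrite eq_le mdist_ge0 andbT leNgt; apply/negP => d_gt0.
have [N /(_ _ (leqnn N)) ltN] := natSinv_lt (divr_gt0 d_gt0 (ltr0n _ 2)).
have [s sp sq] := pq N.
have := metric_triangle p s q; rewrite leNgt => /negP; apply.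
rewrite [ltRHS]splitr; apply: ltrD; last exact: le_lt_trans ltN.
by rewrite metric_sym; exact: le_lt_trans ltN.
Qed.

Lemma metric_name_functional : functional_rel metric_name.
Proof.
move=> x p q xp xq; apply: close_eq => n.
have [s [Ss gs] sp] := xp n; have [t [St gt]] := xq n.
by rewrite -(S_inj Ss St) ?gs ?gt // => sq; exists s.
Qed.

Lemma metric_name_surjective p : exists x, metric_name x p.
Proof.
have /choice[s sP] : forall n, exists s, S s /\ (mdist s p < eps n)%R.
  by move=> n; have [s Ss sp] := S_near p n; exists s.
by exists (g \o s) => n; exists (s n); [case: (sP n)|apply/ltW; case: (sP n)].
Qed.

(** By completeness, the sequences naming some point are those satisfying the
Cauchy condition below, where each constraint involves two entries. *)
Let consistent : set baire := \bigcap_n \bigcap_m [set x | exists s t,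
  [/\ S s, S t, g s = x n, g t = x m & (mdist s t <= eps n + eps m)%R]].

Let consistentE : decoded_in metric_name setT = consistent.
Proof.
apply/seteqP; split => [x [p xp _] n _ m _|x xC].
  have [s [Ss gs] sp] := xp n; have [t [St gt] tp] := xp m.
  exists s, t; split => //; apply: le_trans (metric_triangle s p t) _.
  by apply: lerD => //; rewrite metric_sym.
have /choice[s sP] : forall n, exists s, S s /\ g s = x n.
  by move=> n; have [s [_ [? _ ? _ _]]] := xC n I n I; exists s.
have sd n m : (mdist (s n) (s m) <= eps n + eps m)%R.
  have [t [u [St Su gt gu tu]]] := xC n I m I.
  have [[Sn gn] [Sm gm]] := (sP n, sP m).
  have -> : s n = t by apply: S_inj; rewrite ?gn.
  by have -> : s m = u by apply: S_inj; rewrite ?gm.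
have [l sl] : exists l : P, s @ \oo --> l.
  apply: P_complete; apply: cauchy_exP => e e0.
  have [N eN] := natSinv_lt (divr_gt0 e0 (ltr0n _ 2)).
  exists (s N); exists N => // m /= Nm; rewrite ballEmdist /=.
  by apply: le_lt_trans (sd _ _) _; rewrite [ltRHS]splitr ltrD ?eN.
exists l => // n; exists (s n) => //.
apply/ler_addgt0Pr => e e0; have e2 : (0 < e / 2)%R by rewrite divr_gt0.
have [N eN] := natSinv_lt e2.
have /metricType_numDomainType.cvgrPdist_lt/(_ _ e2)[M _ lM] := sl.
pose m := maxn N M.
apply: le_trans (metric_triangle _ (s m) _) _.
rewrite [X in (_ <= _ + X)%R]splitr addrA; apply: lerD.
  by apply: le_trans (sd _ _) _; rewrite lerD2l ltW // eN // leq_maxl.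
by rewrite metric_sym ltW // lM //= leq_maxr.
Qed.

Let suslin_consistent : suslin consistent.
Proof.
apply: suslin_bigcap => n; apply: suslin_bigcap => m.
apply: (@suslin_finitary (maxn n m).+1) => x y xy [s [t [? ? gs gt ?]]].
by exists s, t; split => //; rewrite ?gs ?gt xy // ltnS ?leq_maxl ?leq_maxr.
Qed.

(** For open [O], that the named point lies in [O] is witnessed by one entry of
the name: some closed ball given by the name is contained in [O]. *)
Let inside (O : set P) n : set baire :=
  [set x | forall s p, S s -> g s = x n -> (mdist s p <= eps n)%R -> O p].

Let insideP O x p : open O -> metric_name x p ->
  O p <-> exists n, inside O n x.
Proof.
move=> oO xp; split=> [Op|[n xO]]; last first.
  by have [s [Ss gs]] := xp n; exact: xO.
have /nbhs_ballP[e /= e0 eO] := open_nbhs_nbhs (conj oO Op).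
have [n /(_ _ (leqnn n)) en] := natSinv_lt (divr_gt0 e0 (ltr0n _ 2)).
exists n => s q Ss gs sq; apply: eO; rewrite ballEmdist /=.
have [t [St gt]] := xp n; rewrite -(S_inj Ss St) ?gs ?gt // => sp.
apply: le_lt_trans (metric_triangle p s q) _.
rewrite [ltRHS]splitr; apply: ltrD; last exact: le_lt_trans en.
by rewrite metric_sym; exact: le_lt_trans en.
Qed.

Lemma suslin_decoded_open O : open O ->
  suslin (decoded_in metric_name O) /\ suslin (decoded_in metric_name (~` O)).
Proof.
move=> oO.
have fin n x y : agree n.+1 x y -> inside O n x -> inside O n y.
  by move=> xy xO s p; rewrite -(xy n (ltnSn n)); exact: xO.
split.
  have -> : decoded_in metric_name O = consistent `&` \bigcup_n inside O n.
    rewrite -consistentE; apply/seteqP; split => [x [p xp Op]|x [[p xp _] [n _ xO]]].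
      split; first by exists p.
      by have [n xO] := (insideP oO xp).1 Op; exists n.
    by exists p => //; apply/(insideP oO xp); exists n.
  apply: (suslinI suslin_consistent); apply: suslin_bigcup => n.
  exact: (suslin_finitary (fin n)).
have -> : decoded_in metric_name (~` O) = consistent `&` \bigcap_n ~` inside O n.
  rewrite -consistentE; apply/seteqP; split => [x [p xp Op]|x [[p xp _] xO]].
    split; first by exists p.
    by move=> n _ xO; apply/Op/(insideP oO xp); exists n.
  by exists p => // /(insideP oO xp)[n]; exact: xO.
apply: (suslinI suslin_consistent); apply: suslin_bigcap => n.
apply: (@suslin_finitary n.+1) => x y /agree_sym yx xO yO.
by apply: xO; exact: fin yO.
Qed.

Lemma suslin_decoded_borel B : <<s @open P >> B ->
  suslin (decoded_in metric_name B).
Proof.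
apply: suslin_decoded_sigma; first exact: metric_name_functional.
  by rewrite consistentE.
exact: suslin_decoded_open.
Qed.

Lemma dense_balls_separate (p q : P) :
  (forall k n, (exists2 s, S s /\ g s = k & mdist s p < eps n)%R <->
               (exists2 s, S s /\ g s = k & mdist s q < eps n)%R) -> p = q.
Proof.
move=> pq; apply: close_eq => n; have [s Ss sp] := S_near p n.
have [|t [St gt] tq] := (pq (g s) n).1; first by exists s.
by exists s; apply: ltW => //; rewrite -(S_inj St Ss gt).
Qed.

End PolishCoding.

(** The names of a Polish space are transported along the bijection [f]. *)
Lemma standard_borel_coded (R : realType) d (T : measurableType d) :
  standard_borel R T -> baire_coded [set: T].
Proof.
move=> [P [P_complete [S /countable_injP[g g_inj] S_dense]] [f f_bij mT]].
have [h fK hK] := f_bij.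
exists (fun x t => metric_name S g x (f t)); split.
- by move=> x t u xt xu; apply: (can_inj fK); exact: (metric_name_functional g_inj xt xu).
- by move=> t; split=> // _; exact: metric_name_surjective.
rewrite mT => _ [B mB <-]; have := suslin_decoded_borel P_complete g_inj mB.
congr suslin; apply/seteqP; split => [x [p xp Bp]|x [t xt [_ Bt]]].
  by exists (h p); rewrite ?setTI /= hK.
by exists (f t).
Qed.

Lemma standard_borel_separated (R : realType) d (T : measurableType d) :
  standard_borel R T -> countably_separated T.
Proof.
move=> [P [_ [S /countable_injP[g g_inj] S_dense]] [f f_bij mT]].
pose V k n : set P := [set p |
  exists2 s, S s /\ g s = k & (mdist s p < n.+1%:R^-1)%R].
have oV k n : open (V k n).
  have -> : V k n = \bigcup_(s in S `&` g @^-1` [set k])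
      [set p | (mdist s p < n.+1%:R^-1)%R].
    by apply/seteqP; split.
  by apply: bigcup_open => s _; exact: open_metric_ball.
exists (fun m => if unpickle m is Some (k, n) then f @^-1` V k n else setT).
  move=> m; case: (unpickle m) => [[k n]|]; last exact: measurableT.
  rewrite mT; exists (V k n); last by rewrite setTI.
  exact: sub_sigma_algebra.
move=> t u tu; apply: (bij_inj f_bij).
apply: (dense_balls_separate S_dense g_inj) => k n.
by have := tu (pickle (k, n)); rewrite pickleK.
Qed.

Lemma analytic_coded (R : realType) d (T : measurableType d) (A : set T) :
  analytic R A -> baire_coded A.
Proof.
move=> [d' [W [/standard_borel_coded cW [B [f [mB mf ->]]]]]].
by have := baire_coded_image cW mB mf; rewrite setTI.
Qed.

(** * The Kleene-Brouwer order *)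

(** In the Kleene-Brouwer order a sequence lies below its proper prefixes, and
otherwise the first difference decides.  This is the dual of the lexicographic
order over the dual of [nat]. *)
Definition kb (s t : seq nat) : bool :=
  ((t : seqlexi nat^d) <= (s : seqlexi nat^d))%O.

Lemma kb_refl s : kb s s. Proof. exact: lexx. Qed.

Lemma kb_anti s t : kb s t -> kb t s -> s = t.
Proof. by move=> st ts; apply: (@le_anti _ (seqlexi nat^d)); apply/andP; split. Qed.

Lemma kb_trans s t u : kb s t -> kb t u -> kb s u.
Proof. by move=> st tu; exact: le_trans tu st. Qed.

Lemma kb_total s t : kb s t \/ kb t s.
Proof. by apply/orP; exact: le_total. Qed.

Lemma kb_cons a s b t : kb (a :: s) (b :: t) = (a < b) || (a == b) && kb s t.
Proof.
rewrite /kb lexi_cons /= !leEdual leEnat; case: ltngtP => //=.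
Qed.

Lemma kb_cat u s t : kb (u ++ s) (u ++ t) = kb s t.
Proof. by elim: u => //= a u IH; rewrite kb_cons ltnn eqxx. Qed.

(** The branch is built greedily, extending [u] by the least [n] for which
[rcons u n] is a prefix of a member of [S].  The invariant [below] is that the
members of [S] extending [u] are a nonempty initial segment of [S].  As [S] has
no least element, such a segment is not reduced to [u]; and the members
extending [rcons u n] with [n] least form again an initial segment. *)
Lemma kb_descent (S : set (seq nat)) :
  S !=set0 -> (forall s, S s -> exists2 t, S t & ~~ kb s t) ->
  exists x : baire, forall n, exists t, S (mkseq x n ++ t).
Proof.
move=> [s0 Ss0] noleast.
pose below u := (exists v, S (u ++ v)) /\
  forall s v, S s -> S (u ++ v) -> kb s (u ++ v) -> exists w, s = u ++ w.
have /choice[f fP] : forall u, exists n, below u -> below (rcons u n).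
  move=> u; have [below_u|] := pselect (below u); last by exists 0%N.
  have [[v Suv] init] := below_u.
  have ex_child : exists n, `[< exists w, S (u ++ n :: w) >].
    case: v Suv => [|n w Suv]; last by exists n; apply/asboolP; exists w.
    rewrite cats0 => Su; have [t St /negP ut] := noleast u Su.
    have tu : kb t (u ++ [::]) by rewrite cats0; case: (kb_total u t).
    have [|w tE] := init t [::] St _ tu; first by rewrite cats0.
    case: w tE => [|n w] tE; last by exists n; apply/asboolP; exists w; rewrite -tE.
    by case: ut; rewrite tE cats0 kb_refl.
  case: (ex_minnP ex_child) => n /asboolP[w Sw] n_min.
  exists n => _; split; first by exists w; rewrite cat_rcons.
  move=> s w' Ss; rewrite cat_rcons => Sw' sw'.
  have [[|m z] sE] := init _ _ Ss Sw' sw'.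
    by move: sw'; rewrite sE kb_cat.
  have nm : (n <= m)%N by apply: n_min; apply/asboolP; exists z; rewrite -sE.
  move: sw'; rewrite sE kb_cat kb_cons ltnNge nm /= => /andP[/eqP -> _].
  by exists z; rewrite cat_rcons.
pose u_ k := iter k (fun u => rcons u (f u)) [::].
exists (f \o u_) => n.
have -> : mkseq (f \o u_) n = u_ n.
  by elim: n => // n IH; rewrite mkseqS IH.
suff [] : below (u_ n) by [].
elim: n => [|n /fP] //; split; first by exists s0.
by move=> s v _ _ _; exists s.
Qed.

(** A point [d] of Baire space is read as the characteristic function of a set of
finite sequences, through their codes. *)
Definition node (d : baire) (s : seq nat) : Prop := d (CodeSeq.code s) != 0%N.

Definition kb_code (d : baire) : LOcode :=
  ([set n | d n != 0%N], [set p | [/\ d p.1 != 0%N, d p.2 != 0%N &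
    kb (CodeSeq.decode p.1) (CodeSeq.decode p.2)]]).

Lemma LO_kb_code d : LO (kb_code d).
Proof.
split => /=.
- by move=> [m n] [].
- by move=> m dm; split => //; exact: kb_refl.
- move=> m n [_ _ mn] [_ _ nm]; apply: (can_inj CodeSeq.decodeK).
  exact: kb_anti.
- by move=> m n k [dm _ mn] [_ dk nk]; split => //; exact: kb_trans nk.
- move=> m n dm dn; have [mn|nm] := kb_total (CodeSeq.decode m) (CodeSeq.decode n).
    by left.
  by right.
Qed.

(** Along a branch the prefixes strictly decrease; conversely, a nonempty set of
nodes with no least element yields a branch by [kb_descent]. *)
Lemma well_ordered_kb_code d :
  (forall s t, node d (s ++ t) -> node d s) ->
  well_ordered (kb_code d) <-> ~ exists x : baire, forall n, node d (mkseq x n).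
Proof.
move=> d_tree; split=> [[_ wo] [x xd]|nobranch].
  pose S := [set CodeSeq.code (mkseq x n) | n in [set: nat]].
  have [||_ [n _ <-] n_min] := wo S.
  - by move=> _ [n _ <-]; exact: xd.
  - by exists (CodeSeq.code (mkseq x 0)), 0%N.
  have [|_ _] := n_min (CodeSeq.code (mkseq x n.+1)); first by exists n.+1.
  by rewrite !CodeSeq.codeK mkseqS -cats1 -{1}[mkseq x n]cats0 kb_cat.
split; first exact: LO_kb_code.
move=> S Sd [m0 Sm0]; apply: contrapT => noleast; apply: nobranch.
have [||x xS] := @kb_descent (CodeSeq.decode @` S).
- by exists (CodeSeq.decode m0), m0.
- move=> _ [m Sm <-]; apply: contrapT => m_least; apply: noleast.
  exists m => // n Sn; split; [exact: Sd|exact: Sd|].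
  by apply/negPn/negP => mn; apply: m_least; exists (CodeSeq.decode n) => //; exists n.
exists x => n; have [t [m Sm mE]] := xS n; apply: (d_tree _ t).
by rewrite /node -mE CodeSeq.decodeK; exact: Sd.
Qed.

(** * Well-orders do not form an analytic set *)

Lemma causal_fixpoint (F : nat -> baire -> nat) :
  (forall n x y, agree n x y -> F n x = F n y) -> exists d, forall n, d n = F n d.
Proof.
move=> F_causal.
(* [e n] is the approximation to the solution that is correct below [n]. *)
pose e := fix e n : baire := if n is m.+1 then
  fun i => if i == m then F m (e m) else e m i else fun=> 0%N.
have e_stable n k i : (i < n)%N -> e (n + k)%N i = e n i.
  move=> lt_in; elim: k => [|k IH]; first by rewrite addn0.
  by rewrite addnS /= ltn_eqF // (leq_trans lt_in) // leq_addr.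
exists (fun n => e n.+1 n) => n /=; rewrite eqxx; apply: F_causal => i lt_in.
by rewrite -[in LHS](subnKC lt_in) e_stable.
Qed.

(** This bound is what makes the self-referential tree of
[suslin_neq_well_ordered] well defined by recursion. *)
Lemma size_le_code s : (size s <= CodeSeq.code s)%N.
Proof.
elim: s => //= n s IH; apply: leq_ltn_trans IH _.
rewrite (@leq_trans (CodeSeq.code s).*2.+1) //.
  by rewrite ltnS -addnn leq_addr.
by rewrite leq_pmull // expn_gt0.
Qed.

(** The tree of [d] consists of the sequences [s] that begin a point [z] of the
closed set [C] whose projection agrees with [d] as far as the length of [s]; its
branches are the points of [C] that project to [d].  The point [d] is chosen to
be the characteristic function of its own tree. *)
Lemma suslin_neq_well_ordered (D : set baire) : suslin D ->
  exists d, ~ (D d <-> well_ordered (kb_code d)).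
Proof.
move=> [C [h [clC DE]]].
pose approx d s := exists z,
  [/\ C z, agree (size s) (z \o h) d & agree (size s) z (nth 0%N s)].
have [|d dE] := @causal_fixpoint
  (fun n d => nat_of_bool `[< approx d (CodeSeq.decode n) >]).
  move=> n x y xy; congr (nat_of_bool _); apply: asbool_equiv_eq.
  have le_n : (size (CodeSeq.decode n) <= n)%N.
    by rewrite -[X in (_ <= X)%N]CodeSeq.decodeK size_le_code.
  split=> -[z [Cz zh zs]]; exists z; split => // i ltis; rewrite zh // xy //.
    exact: leq_trans le_n.
  by rewrite (leq_trans ltis).
have nodeP s : node d s <-> approx d s.
  by rewrite /node dE CodeSeq.codeK; case: asboolP.
exists d => Dwo; suff branchP : D d <-> exists x : baire, forall n, node d (mkseq x n).
  have d_tree s t : node d (s ++ t) -> node d s.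
    move=> /nodeP[z [Cz zh zs]]; apply/nodeP; exists z.
    have le_s : (size s <= size (s ++ t))%N by rewrite size_cat leq_addr.
    split=> // i ltis; first by rewrite zh // (leq_trans ltis).
    by rewrite zs ?nth_cat ?ltis // (leq_trans ltis).
  by have := well_ordered_kb_code d_tree; tauto.
rewrite DE; split=> [[z Cz zd]|[x xd]].
  exists z => n; apply/nodeP; exists z; rewrite size_mkseq; split => // i ltin.
    by rewrite -zd.
  by rewrite nth_mkseq.
have {}xd n : exists z, [/\ C z, agree n (z \o h) d & agree n z x].
  have /nodeP[z []] := xd n; rewrite size_mkseq => Cz zh zx.
  by exists z; split=> // i ltin; rewrite zx // nth_mkseq.
exists x.
  by apply: clC => n; have [z [Cz _ /agree_sym]] := xd n; exists z.
apply/funext => i /=; have [z [_ zd zx]] := xd (maxn i (h i)).+1.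
by rewrite -zx ?[LHS](zd i) // ltnS ?leq_maxl ?leq_maxr.
Qed.

Lemma suslin_preimage_kb_code B : measurable B -> suslin (kb_code @^-1` B).
Proof.
have finitary n (A : set LOcode) :
    (forall d d', agree n d d' -> A (kb_code d) -> A (kb_code d')) ->
    suslin (kb_code @^-1` A) /\ suslin (kb_code @^-1` (~` A)).
  move=> An; split; apply: (@suslin_finitary n) => d d' /[dup] dd' /agree_sym d'd.
    exact: An.
  by move=> nA /(An _ _ d'd).
have m1 B1 : measurable B1 -> suslin (kb_code @^-1` (fst @^-1` B1)).
  apply: (suslin_preimage_sigma (f := fst \o kb_code)) => _ [n _ <-].
  apply: (finitary n.+1 [set I : LOcode | I.1 n]) => d d' dd' /=.
  by rewrite (dd' n).
have m2 B2 : measurable B2 -> suslin (kb_code @^-1` (snd @^-1` B2)).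
  apply: (suslin_preimage_sigma (f := snd \o kb_code)) => _ [[m n] _ <-].
  apply: (finitary (maxn m n).+1 [set I : LOcode | I.2 (m, n)]) => d d' dd' /=.
  by rewrite !dd' // ltnS ?leq_maxl ?leq_maxr.
apply: suslin_preimage_sigma => _ [[B1 mB1 <-]|[B2 mB2 <-]]; rewrite setTI.
  by split; [exact: m1|apply: (m1 (~` B1)); exact: measurableC].
by split; [exact: m2|apply: (m2 (~` B2)); exact: measurableC].
Qed.

Lemma Pow_separated (T : countType) : countably_separated (Pow T).
Proof.
exists (fun k => if unpickle k is Some n then [set A : Pow T | A n] else setT).
  move=> k; case: (unpickle k) => [n|]; last exact: measurableT.
  by apply: sub_sigma_algebra; exists n.
move=> A B AB; apply/funext => n; apply/propext.
by have := AB (pickle n); rewrite pickleK.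
Qed.

Theorem well_orders_not_coded (D : set LOcode) :
  baire_coded D -> ~ forall I, LO I -> D I <-> well_ordered I.
Proof.
move=> cD Dwo.
have sepLO : countably_separated LOcode.
  by apply: countably_separatedX; exact: Pow_separated.
have [d []] := suslin_neq_well_ordered
  (suslin_preimage_coded sepLO suslin_preimage_kb_code cD).
exact/Dwo/LO_kb_code.
Qed.

(** * Reflection for refining analytic families *)

Lemma LO_omega_star : LO omega_star.
Proof.
split => //=.
- by move=> m n /= nm mn; apply/eqP; rewrite eqn_leq mn nm.
- by move=> m n k /= nm kn; exact: leq_trans nm.
- by move=> m n _ _; apply/orP; exact: leq_total.
Qed.

Lemma embeds_omega_star I : LO I -> ~ well_ordered I -> embeds omega_star I.
Proof.
move=> LI not_wo; have [dom refl anti trans total] := LI.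
have [S [SI [m0 Sm0] S_min]] : exists S : set nat, [/\ S `<=` I.1, S !=set0 &
    forall m, S m -> exists n, S n /\ ~ I.2 (m, n)].
  apply: contrapT => noS; apply: not_wo; split=> // S SI S0.
  apply: contrapT => S_min; apply: noS; exists S; split=> // m Sm.
  apply: contrapT => m_min; apply: S_min; exists m => // n Sn.
  by apply: contrapT => mn; apply: m_min; exists n.
have /choice[f fP] : forall m, exists n, S m -> S n /\ ~ I.2 (m, n).
  move=> m; have [/S_min[n]|] := pselect (S m); first by exists n.
  by exists 0%N.
pose x k := iter k f m0.
have xS k : S (x k) by elim: k => //= k /fP[].
have x_lt k : ~ I.2 (x k, x k.+1) by case: (fP _ (xS k)).
have x_le k n : I.2 (x (n + k)%N, x n).
  elim: k => [|k IH]; first by rewrite addn0; apply/refl/SI.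
  rewrite addnS; apply: trans IH.
  have [//|/x_lt//] := total _ _ (SI _ (xS (n + k).+1)) (SI _ (xS (n + k))).
exists x; split => [k _|m n _ _]; first exact/SI.
split=> /= [nm|mn]; first by rewrite -(subnKC nm).
rewrite leqNgt; apply/negP => lt_mn; apply: (x_lt m); apply: trans mn _.
by rewrite -(subnKC lt_mn).
Qed.

Lemma isomorphic_refl I : isomorphic I I.
Proof. by exists id; [split|split => // m ? ; exists m]. Qed.

Definition otype I (wo : well_ordered I) : omega1 :=
  Omega1 (ex_intro2 _ _ I wo erefl).

Lemma order_class_otype I (wo : well_ordered I) : order_class (otype wo) I.
Proof. by split; [case: wo|exact: isomorphic_refl]. Qed.

(** If [N] met every stage, the codes [I] whose section of [Q] meets [N] would be
exactly the well-orders: at an ill-founded [I], refinement along the embedding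
of [omega_star] puts the section inside the limit relation, which misses [N]. *)
Lemma coded_avoids_some_stage (R : realType) d (Z : measurableType d)
    (X : set Z) (E_ : omega1 -> set (Z * Z)) (N : set (Z * Z)) :
  countably_separated Z -> uniformly_analytic R X E_ ->
  baire_coded N -> N `<=` X `*` X ->
  (forall p, N p -> ~ (\bigcap_(a in [set: omega1]) E_ a) p) ->
  exists a, forall p, N p -> ~ E_ a p.
Proof.
move=> sepZ [Q [[B /analytic_coded cB QE] Q_ref EQ Q_star]] cN NX N_lim.
apply: contrapT => N_meets.
have N_E a : exists2 p, N p & E_ a p.
  apply: contrapT => h; apply: N_meets; exists a => p Np Ep.
  by apply: h; exists p.
pose D := snd @` (B `&` fst @^-1` N).
have cD : baire_coded D.
  have cBN := baire_coded_restrict_preimage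
    (countably_separatedX sepZ sepZ) measurable_fst cB cN.
  by have := baire_coded_image cBN measurableT measurable_snd; rewrite setIT.
apply: (well_orders_not_coded cD) => I LI; split => [[[p J] [/= Bp Np] /= JI]|wo].
  subst J; apply: contrapT => /(embeds_omega_star LI) sI.
  apply: (N_lim p Np); rewrite -Q_star.
  apply: (Q_ref _ _ LO_omega_star LI sI); rewrite /ysection /= inE QE.
  by split => //; split => //; exact: NX.
have [p Np] := N_E (otype wo).
rewrite (EQ _ _ (order_class_otype wo)) /ysection /= inE QE => -[_ Bp].
by exists (p, I).
Qed.

Theorem theorem2 (R : realType) (d : measure_display) (Z : measurableType d)
    (hZ : standard_borel R Z)
    (X Y : set Z) (hX : analytic R X) (hY : analytic R Y)
    (K : {fun X >-> Y}) (hK : analytic_map R K)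
    (E F : set (Z * Z))
    (hE : equivalence_on X E) (hEborel : borel_in (X `*` X) E)
    (hF : equivalence_on Y F) (hFborel : borel_in (Y `*` Y) F)
    (E_ F_ : omega1 -> set (Z * Z))
    (hE_ : refining_analytic_equivalence R X E_)
    (hE_unif : uniformly_analytic R X E_)
    (hF_ : refining_analytic_equivalence R Y F_)
    (hF_unif : uniformly_analytic R Y F_)
    (hFE : forall x x', X x -> X x' ->
      (\bigcap_(a in [set: omega1]) F_ a) (K x, K x') -> E (x, x'))
    (hEF : forall x x', X x -> X x' ->
      (\bigcap_(a in [set: omega1]) E_ a) (x, x') -> F (K x, K x')) :
  exists a b : omega1,
    (forall x x', X x -> X x' -> F_ a (K x, K x') -> E (x, x')) /\
    (forall x x', X x -> X x' -> E_ b (x, x') -> F (K x, K x')).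
Proof.
have sepZ := standard_borel_separated hZ.
have KY x : X x -> Y (K x) by move=> Xx; exact: (@funS _ _ _ _ K).
pose G := [set p : Z * Z | X p.1 /\ p.2 = K p.1].
have cG : baire_coded G.
  have [B /analytic_coded cB GE] := hK; rewrite /G GE.
  apply: (@baire_coded_restrict_preimage _ _ _ _ _ _ id) => //.
    exact: countably_separatedX.
  exact: (baire_codedX (analytic_coded hX) (analytic_coded hY)).
(* Points of [G `*` G] are of the form [((x, K x), (x', K x'))]. *)
have cGG := baire_codedX cG cG.
have m1 : measurable_fun setT (fun q : (Z * Z) * (Z * Z) => (q.1.1, q.2.1)).
  apply: measurable_fun_pair; apply: (measurableT_comp measurable_fst).
    exact: measurable_fst.
  exact: measurable_snd.
have m2 : measurable_fun setT (fun q : (Z * Z) * (Z * Z) => (q.1.2, q.2.2)).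
  apply: measurable_fun_pair; apply: (measurableT_comp measurable_snd).
    exact: measurable_fst.
  exact: measurable_snd.
have [E' mE' EE'] := hEborel; have [F' mF' FF'] := hFborel.
pose NF := [set p | exists x x',
  [/\ X x, X x', p = (K x, K x') & ~ E (x, x')]].
pose NE := [set p | [/\ X p.1, X p.2 & ~ F (K p.1, K p.2)]].
have cNF : baire_coded NF.
  have mE'C := m1 measurableT _ (measurableC mE').
  have := baire_coded_image cGG mE'C (measurable_funS measurableT (@subsetT _ _) m2).
  congr baire_coded; apply/seteqP; split => [p [[[x y] [x' y']]]|p].
    move=> [[[/= Xx ->] [/= Xx' ->]] [_ nE] <-].
    by exists x, x'; split=> //; rewrite EE' => -[].
  move=> [x [x' [Xx Xx' -> nE]]].
  exists ((x, K x), (x', K x')) => //; split=> //; split=> //= E'xx'.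
  by apply: nE; rewrite EE'.
have cNE : baire_coded NE.
  have mF'C := m2 measurableT _ (measurableC mF').
  have := baire_coded_image cGG mF'C (measurable_funS measurableT (@subsetT _ _) m1).
  congr baire_coded; apply/seteqP; split => [p [[[x y] [x' y']]]|[x x'] [/= Xx Xx' nF]].
    move=> [[[/= Xx ->] [/= Xx' ->]] [_ nF] <-].
    by split=> //=; rewrite FF' => -[].
  exists ((x, K x), (x', K x')) => //; split=> //; split=> //= F'xx'.
  by apply: nF; rewrite FF'; split => //; split; exact: KY.
have [||a aP] := coded_avoids_some_stage sepZ hF_unif cNF.
- by move=> _ [x [x' [Xx Xx' -> _]]]; split; exact: KY.
- by move=> _ [x [x' [Xx Xx' -> nE]]] /(hFE x x' Xx Xx').
have [||b bP] := coded_avoids_some_stage sepZ hE_unif cNE.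
- by move=> p [].
- by move=> [x x'] [/= Xx Xx' nF] /(hEF x x' Xx Xx').
exists a, b; split => x x' Xx Xx' xx'; apply: contrapT => nxx'.
- by apply: (aP (K x, K x')) xx'; exists x, x'.
- exact: (bP (x, x')) xx'.
Qed.
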